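(* Let $S$ be a quasi-complete range set with countable coinitiality. Let $\mathfrak{G}$ be an $S$-ultra-singular transmissible parameter. Then for every non-discrete $S$-valued ultrametrizable topological space $X$, the set of all $d\in\mathrm{UM}(X,S)$ for which $(X,d)$ satisfies the anti-$\mathfrak{G}$-transmissible property is a dense $G_\delta$ subset of the space $(\mathrm{UM}(X,S),\mathcal{UD}_X^S)$.
   Context: A range set is a set $S\subseteq[0,\infty)$ with $0\in S$. It is quasi-complete if for some $C\in[1,\infty)$, for every bounded $E\subseteq S$ there is $s\in S$ with $\sup E\le s\le C\sup E$ (suprema in $[0,\infty]$). It has countable coinitiality if there is a strictly decreasing sequence in $S$ converging to $0$. A metric $d$ on $X$ is an ultrametric if $d(x,y)\le d(x,z)\lor d(z,y)$ for all $x,y,z$ ($\lor$ = maximum); it is $S$-valued if $d(X^2)\subseteq S$. For a topological space $X$, $\mathrm{M}(X)$ (resp. $\mathrm{UM}(X,S)$) is the set of all metrics (resp. $S$-valued ultrametrics) on $X$ generating the topology of $X$; $X$ is $S$-valued ultrametrizable if $\mathrm{UM}(X,S)\ne\emptyset$. $\mathcal{D}_X(d,e)=\sup_{x,y\in X}|d(x,y)-e(x,y)|\in[0,\infty]$ is a ($[0,\infty]$-valued) metric on $\mathrm{M}(X)$. For $d,e\in\mathrm{UM}(X,S)$, $\mathcal{UD}_X^S(d,e)\in[0,\infty]$ is the infimum of $\epsilon\in S\sqcup\{\infty\}$ such that $d(x,y)\le e(x,y)\lor\epsilon$ and $e(x,y)\le d(x,y)\lor\epsilon$ for all $x,y\in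 X$; it is a ($[0,\infty]$-valued) ultrametric on $\mathrm{UM}(X,S)$. $\mathbb{N}$ is the set of positive integers, $\mathcal{P}^*(\mathbb{N})$ the set of non-empty subsets of $\mathbb{N}$, $\mathcal{F}(T)$ the set of closed subsets of a topological space $T$. For $W\in\mathcal{P}^*(\mathbb{N})$ and a set $E$, $\mathrm{Seq}(W,E)$ is the set of all finite injective sequences $\{a_i\}_{i=1}^n$ in $E$ with $n\in W$. A transmissible parameter is a sextuple $\mathfrak{G}=(Q,P,F,G,Z,\phi)$, where $Q$ is an at most countable set, $P$ a topological space, $F:Q\to\mathcal{F}(P)$ and $G:Q\to\mathcal{P}^*(\mathbb{N})$ maps, $Z$ a set, and $\phi$ assigns to each $q\in Q$ and each metrizable space $X$ a map $\phi^{q,X}:\mathrm{Seq}(G(q),X)\times Z\times\mathrm{M}(X)\to P$, such that for every metrizable space $X$, $q\in Q$, $z\in Z$: (TP1) for every $a\in\mathrm{Seq}(G(q),X)$ the map $d\mapsto\phi^{q,X}(a,z,d)$ from $(\mathrm{M}(X),\mathcal{D}_X)$ to $P$ is continuous; (TP2) for every $d\in\mathrm{M}(X)$, every subset $B\subseteq X$ and every $a\in\mathrm{Seq}(G(q),B)$, $\phi^{q,X}(a,z,d)=\phi^{q,B}(a,z,d|_{B^2})$. A metric space $(X,d)$ satisfies the $\mathfrak{G}$-transmissible property if there is $q\in Q$ such that for all $z\in Z$ and all $a\in\mathrm{Seq}(G(q),X)$, $\phi^{q,X}(a,z,d)\in F(q)$. It satisfies the anti-$\mathfrak{G}$-transmissible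 property if it does not satisfy the $\mathfrak{G}$-transmissible property, i.e. for every $q\in Q$ there exist $z\in Z$ and $a\in\mathrm{Seq}(G(q),X)$ with $\phi^{q,X}(a,z,d)\in P\setminus F(q)$. $\mathfrak{G}$ is $S$-ultra-singular if for each $q\in Q$ and every $\epsilon\in(0,\infty)$ there exist $z\in Z$, a finite $S$-valued ultrametric space $(R,d_R)$ and an enumeration $R=\{r_i\}_{i=1}^{\mathrm{card}(R)}$ such that: the diameter of $(R,d_R)$ is at most $\epsilon$; $\mathrm{card}(R)\in G(q)$; and $\phi^{q,R}(\{r_i\}_{i=1}^{\mathrm{card}(R)},z,d_R)\in P\setminus F(q)$.
   Formalization: The formal version also assumes that each map φ is invariant under bijective isometries between metrizable spaces; without this, φ could depend on the names of points and the claim fails. *)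

(* Defs.v *)
From HB Require Import structures.
From mathcomp Require Import all_boot all_order all_algebra.
From mathcomp Require Import all_classical all_reals all_analysis.
From mathcomp Require Import borel_hierarchy.

Set Implicit Arguments.
Unset Strict Implicit.
Unset Printing Implicit Defensive.

Import Order.TTheory GRing.Theory Num.Theory.
Import numFieldNormedType.Exports.

Local Open Scope classical_set_scope.
Local Open Scope ring_scope.

Definition range_set (R : realType) (S : set R) : Prop :=
  S 0 /\ (forall s, S s -> 0 <= s).

(* Suprema are taken in [0, +oo]; for a bounded set of nonnegative reals this
   agrees with the real [sup], including for the empty set, as
   [sup set0 = 0]. *)
Definition quasi_complete (R : realType) (S : set R) : Prop :=
  exists2 C : R, 1 <= C &
    forall E : set R, E `<=` S -> has_ubound E ->
      exists2 s, S s & sup E <= s <= C * sup E.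

Definition countable_coinitiality (R : realType) (S : set R) : Prop :=
  exists u : nat -> R,
    [/\ forall n, S (u n), decreasing_seq u & u @ \oo --> (0 : R)].

Definition is_metric (R : realType) (X : Type) (d : X -> X -> R) : Prop :=
  [/\ forall x y, 0 <= d x y,
      forall x y, d x y = 0 <-> x = y,
      forall x y, d x y = d y x &
      forall x y z, d x y <= d x z + d z y].

Definition is_ultrametric (R : realType) (X : Type) (d : X -> X -> R) : Prop :=
  is_metric d /\ (forall x y z, d x y <= Num.max (d x z) (d z y)).

Definition metric_open (R : realType) (T : Type) (D : T -> T -> \bar R) :
    set (set T) :=
  [set U | forall x, U x ->
     exists2 e : R, 0 < e & [set y | (D x y < e%:E)%E] `<=` U].

(* [T] with the topology of the extended metric [D]. *)
Definition ext_metric_space (R : realType) (T : Type) (D : T -> T -> \bar R) :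
  Type := T.

Section ext_metric_topology.
Variables (R : realType) (T : Type) (D : T -> T -> \bar R).

Let opT : metric_open D setT.
Proof. by move=> x _; exists 1. Qed.

Let opI : setI_closed (metric_open D).
Proof.
move=> A B oA oB x [Ax Bx].
have [e e0 eA] := oA x Ax; have [f f0 fB] := oB x Bx.
exists (Num.min e f); first by rewrite lt_min e0.
move=> y /= Dxy; split; [apply: eA|apply: fB] => /=;
  by apply: lt_le_trans Dxy _; rewrite lee_fin ge_min lexx ?orbT.
Qed.

Let op_bigU (I : Type) (f : I -> set T) :
  (forall i, metric_open D (f i)) -> metric_open D (\bigcup_i f i).
Proof.
move=> of_ x [i _ fix_]; have [e e0 ef] := of_ i x fix_.
by exists e => // y /ef fy; exists i.
Qed.

HB.instance Definition _ := gen_eqMixin (ext_metric_space D).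
HB.instance Definition _ := gen_choiceMixin (ext_metric_space D).
HB.instance Definition _ :=
  isOpenTopological.Build (ext_metric_space D) opT opI op_bigU.

End ext_metric_topology.

Definition generates_topology (R : realType) (X : topologicalType)
    (d : X -> X -> R) : Prop :=
  forall U : set X, open U <-> metric_open (fun x y => (d x y)%:E) U.

Definition Met (R : realType) (X : topologicalType) : set (X -> X -> R) :=
  [set d | is_metric d /\ generates_topology d].
Arguments Met R X : clear implicits.

Definition UMet (R : realType) (S : set R) (X : topologicalType) :
    set (X -> X -> R) :=
  [set d | [/\ is_ultrametric d, forall x y, S (d x y) &
               generates_topology d]].
Arguments UMet {R} S X.

(* The [maxe 0] only matters for empty [X], where [ereal_sup set0 = -oo]. *)
Definition sup_dist (R : realType) (X : Type) (d e : X -> X -> R) : \bar R :=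
  maxe 0%E (ereal_sup [set `|d p.1 p.2 - e p.1 p.2|%:E | p in [set: X * X]]).

Definition UD (R : realType) (S : set R) (X : Type) (d e : X -> X -> R) :
    \bar R :=
  ereal_inf [set eps : \bar R |
    ([set s%:E | s in S] `|` [set +oo%E]) eps /\
    forall x y, ((d x y)%:E <= maxe (e x y)%:E eps)%E /\
                ((e x y)%:E <= maxe (d x y)%:E eps)%E].

Definition Met_space (R : realType) (X : topologicalType) : Type :=
  @ext_metric_space R (set_type (Met R X))
    (fun d e => sup_dist (set_val d) (set_val e)).
Arguments Met_space R X : clear implicits.

Definition UMet_space (R : realType) (S : set R) (X : topologicalType) : Type :=
  @ext_metric_space R (set_type (UMet S X))
    (fun d e => UD S (set_val d) (set_val e)).
Arguments UMet_space {R} S X.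

Definition Seq (W : set nat) (E : eqType) : set (seq E) :=
  [set a | uniq a /\ W (size a)].
Arguments Seq W E : clear implicits.

(* [tp_phi q X] is total: only its values on [Seq (tp_G q) X], [tp_Z] and
   [Met R X] are meaningful, so in particular only metrizable [X] matter.

   [tp_isometry] expresses the usual identification of isometric spaces. A set
   theoretic reading of the other axioms would let [tp_phi] depend on the names
   of the points (e.g. on whether a point belongs to a prescribed set); then a
   finite space would say nothing about its isometric copies inside other
   spaces. It also rules out any dependency on the choice structure bundled in
   [topologicalType]. *)
Record transmissible_parameter (R : realType) := TransmissibleParameter {
  tp_Q : Type ;
  tp_P : topologicalType ;
  tp_F : tp_Q -> set tp_P ;
  tp_G : tp_Q -> set nat ;
  tp_Z : Type ;
  tp_phi : forall (q : tp_Q) (X : topologicalType),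
    seq X -> tp_Z -> (X -> X -> R) -> tp_P ;
  tp_Q_countable : countable [set: tp_Q] ;
  tp_F_closed : forall q, closed (tp_F q) ;
  tp_G_neq0 : forall q, tp_G q !=set0 ;
  tp_G_gt0 : forall q n, tp_G q n -> (0 < n)%N ;
  tp_continuous : forall (X : topologicalType) q z (a : seq X),
    Seq (tp_G q) _ a ->
    continuous (fun d : Met_space R X => tp_phi q a z (set_val d)) ;
  tp_restrict : forall (X : topologicalType) q z (d : X -> X -> R)
      (B : set X) (a : seq (set_type B)),
    Met R X d -> Seq (tp_G q) _ a ->
    tp_phi q (map set_val a) z d =
    tp_phi q a z (fun x y => d (set_val x) (set_val y)) ;
  tp_isometry : forall (X Y : topologicalType) q z (d : X -> X -> R)
      (e : Y -> Y -> R) (f : X -> Y) (a : seq X),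
    Met R X d -> Met R Y e -> bijective f -> (forall x y, e (f x) (f y) = d x y) ->
    Seq (tp_G q) _ a ->
    tp_phi q (map f a) z e = tp_phi q a z d
}.

Definition transmissible (R : realType) (G : transmissible_parameter R)
    (X : topologicalType) (d : X -> X -> R) : Prop :=
  exists q : tp_Q G, forall (z : tp_Z G) (a : seq X),
    Seq (tp_G q) _ a -> tp_F q (tp_phi q a z d).

Definition anti_transmissible (R : realType) (G : transmissible_parameter R)
    (X : topologicalType) (d : X -> X -> R) : Prop :=
  ~ transmissible G d.

Definition diameter (R : realType) (X : Type) (d : X -> X -> R) : \bar R :=
  ereal_sup [set (d p.1 p.2)%:E | p in [set: X * X]].

(* The finite space is [Y]; [r] is its enumeration. *)
Definition ultra_singular (R : realType) (S : set R)
    (G : transmissible_parameter R) : Prop :=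
  forall (q : tp_Q G) (eps : R), 0 < eps ->
    exists (z : tp_Z G) (Y : topologicalType) (d : Y -> Y -> R) (r : seq Y),
      [/\ UMet S Y d,
          uniq r /\ (forall y, y \in r),
          (diameter d <= eps%:E)%E,
          tp_G q (size r) &
          ~ tp_F q (tp_phi q r z d)].

(* Main.v *)
(* G_delta: the sup distance is at most UD, so by (TP1) the anti-transmissible
   metrics form a countable intersection over q of open sets.

   Density: given an ultrametric d and a non-isolated point p, cut a small ball
   around p into annuli v (i+1) < d(p, x) <= v i with v i in S decreasing to 0,
   chosen so sparse that the i-th annulus has at least as many points as the finite
   singular space Y_i of diameter at most v i attached to the i-th parameter.
   On that annulus replace d by max(min(d, m_i), rho_i o f_i), where f_i is a
   locally constant map onto Y_i and m_i in S is below all distances of Y_i; the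
   chosen points then form an isometric copy of Y_i. Points of different annuli
   get the larger of their two outer radii as distance. The result generates the
   same topology and is within v 0 of d. *)

Require Import Defs.
From mathcomp Require Import all_boot all_order all_algebra.
From mathcomp Require Import all_classical all_reals all_analysis.
From mathcomp Require Import borel_hierarchy.
From mathcomp Require Import lra.

Set Implicit Arguments.
Unset Strict Implicit.
Unset Printing Implicit Defensive.

Import Order.TTheory GRing.Theory Num.Theory.

Local Open Scope classical_set_scope.
Local Open Scope ring_scope.

(** * Ultrametrics: topology, comparison of distances, locally constant maps *)

Section Ultrametrics.
Context {R : realType}.

Lemma is_ultrametricP (X : Type) (d : X -> X -> R) :
  (forall x y, 0 <= d x y) -> (forall x y, d x y = 0 <-> x = y) ->
  (forall x y, d x y = d y x) ->
  (forall x y z, d x y <= Num.max (d x z) (d z y)) -> is_ultrametric d.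
Proof.
move=> d0 dE dC dU; split=> //; split=> // x y z.
apply: le_trans (dU x y z) _.
by rewrite ge_max lerDl lerDr !d0.
Qed.

Lemma metric_xx (X : Type) (d : X -> X -> R) x : is_metric d -> d x x = 0.
Proof. by case=> _ dE _ _; apply/dE. Qed.

(** Makes the distance to [p] locally constant away from [p], so that a small move stays inside one
    annulus. *)
Lemma ultrametric_isosceles (X : Type) (d : X -> X -> R) (p x y : X) :
  is_ultrametric d -> d x y < d p x -> d p y = d p x.
Proof.
move=> [[_ _ dC _] dU] xy.
apply/eqP; rewrite eq_le; apply/andP; split.
  by apply: le_trans (dU _ _ x) _; rewrite ge_max lexx ltW.
have := dU p x y; rewrite le_max => /orP[//|].
by rewrite (dC y x) leNgt xy.
Qed.

Lemma metric_open_fin (X : Type) (d : X -> X -> R) (U : set X) :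
  metric_open (fun x y => (d x y)%:E) U <->
  forall x, U x -> exists2 r : R, 0 < r & forall y, d x y < r -> U y.
Proof.
by split=> oU x /oU[r r0 rU]; exists r => // y xy; apply: rU => /=;
  rewrite ?lte_fin // -lte_fin.
Qed.

Lemma generates_topology_equiv (X : topologicalType) (d e : X -> X -> R) :
  generates_topology d ->
  (forall x r, 0 < r -> exists2 s, 0 < s & forall y, d x y < s -> e x y < r) ->
  (forall x r, 0 < r -> exists2 s, 0 < s & forall y, e x y < s -> d x y < r) ->
  generates_topology e.
Proof.
move=> gd de ed U; rewrite gd !metric_open_fin.
split=> oU x /oU[r r0 rU].
  by have [s s0 sr] := ed x r r0; exists s => // y /sr/rU.
by have [s s0 sr] := de x r r0; exists s => // y /sr/rU.
Qed.

Lemma UMet_Met (S : set R) (X : topologicalType) (d : X -> X -> R) :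
  UMet S X d -> Met R X d.
Proof. by move=> [[md _] _ gd]. Qed.

Lemma Met_restrict (X : topologicalType) (d : X -> X -> R) (B : set X) :
  Met R X d ->
  Met R (set_type B) (fun x y => d (set_val x) (set_val y)).
Proof.
move=> [[d0 dE dC dT] gd]; split.
  split=> // x y; split=> [/dE/val_inj//|->]; exact/dE.
move=> U; rewrite metric_open_fin; split.
  move=> [V /gd/metric_open_fin oV <-] x /oV[r r0 rV].
  by exists r => // y /rV.
move=> oU.
(* The open set of [X] with trace [U] is the union of the balls centred in [B] that meet [B] only
   inside [U]. *)
exists [set y | exists (x : set_type B) r, [/\ d (set_val x) y < r &
   forall z : set_type B, d (set_val x) (set_val z) < r -> U z]].
  apply/gd/metric_open_fin => y [x [r [xy rU]]].
  exists (r - d (set_val x) y); first by rewrite subr_gt0.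
  move=> z yz; exists x, r; split=> //.
  by apply: le_lt_trans (dT _ _ y) _; rewrite -ltrBrDl.
apply/seteqP; split=> y /=.
  by move=> [x [r [xy rU]]]; apply: rU.
move=> /oU[r r0 rU]; exists y, r; split=> //.
by rewrite (metric_xx _ (And4 d0 dE dC dT)).
Qed.

Lemma UD_le (S : set R) (X : Type) (d e : X -> X -> R) (s : R) :
  S s -> (forall x y, d x y <= Num.max (e x y) s) ->
  (forall x y, e x y <= Num.max (d x y) s) -> (UD S d e <= s%:E)%E.
Proof.
move=> Ss de ed; apply: ereal_inf_lbound; split; first by left; exists s.
by move=> x y; rewrite -!EFin_max !lee_fin.
Qed.

Lemma UD_lt (S : set R) (X : Type) (d e : X -> X -> R) (r : R) :
  (UD S d e < r%:E)%E ->
  exists s, [/\ S s, s < r, forall x y, d x y <= Num.max (e x y) s &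
    forall x y, e x y <= Num.max (d x y) s].
Proof.
move=> /ereal_inf_lt[_ [[[s Ss <-]|->] de]] sr; last by rewrite ltNge leey in sr.
exists s; split=> // [x y|x y]; have [] := de x y;
  by rewrite -!EFin_max !lee_fin.
Qed.

(** For each pair the two distances are equal, or both lie between 0 and [s]. This carries (TP1)
    over to the topology of [UD]. *)
Lemma sup_dist_lt (S : set R) (X : Type) (d e : X -> X -> R) (r : R) :
  range_set S -> (forall x y, 0 <= d x y) -> (forall x y, 0 <= e x y) ->
  (UD S d e < r%:E)%E -> (sup_dist d e < r%:E)%E.
Proof.
move=> [_ S0] d0 e0 /UD_lt[s [/S0 s0 sr de ed]].
apply: (@le_lt_trans _ _ s%:E); last by rewrite lte_fin.
rewrite ge_max lee_fin s0 /=; apply: ge_ereal_sup => _ [[x y] _ <-] /=.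
rewrite lee_fin ler_norml.
have := de x y; have := ed x y; have := d0 x y; have := e0 x y.
by rewrite !le_max => ? ? /orP[] ? /orP[] ?; apply/andP; split; lra.
Qed.

Lemma near_nonisolated (X : topologicalType) (d : X -> X -> R) (p : X) (r : R) :
  generates_topology d -> ~ open [set p] -> 0 < r ->
  exists2 x, x <> p & d p x < r.
Proof.
move=> gd np r0; apply: contrapT => H; apply: np.
apply/gd/metric_open_fin => _ ->; exists r => // y py.
by apply: contrapT => yp; apply: H; exists y.
Qed.

(** Zero values are exempt, so that the bound applies to the distances of a finite space with its
    diagonal included. *)
Lemma positive_lower_bound (T : eqType) (s : seq T) (g : T -> R) :
  exists2 m, 0 < m & forall x, x \in s -> 0 < g x -> m <= g x.
Proof.
elim: s => [|x s [m m0 IH]]; first by exists 1.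
case: (ltP 0 (g x)) => gx.
  exists (Num.min m (g x)); first by rewrite lt_min m0.
  move=> y; rewrite inE => /predU1P[->|ys gy]; first by rewrite ge_min lexx orbT.
  by rewrite ge_min IH.
exists m => // y; rewrite inE => /predU1P[->|]; last exact: IH.
by rewrite ltNge gx.
Qed.

(** By induction on [a], the map is overwritten on a small ball around the new point. Local
    constancy survives because two points closer than the radius are both inside the ball or both
    outside. *)
Lemma locally_constant_extension (X : eqType) (Y : Type) (d : X -> X -> R)
    (y0 : Y) (a : seq X) (r : seq Y) :
  is_ultrametric d -> uniq a -> size a = size r ->
  exists (f : X -> Y) (delta : R),
    [/\ 0 < delta, forall x y, d x y < delta -> f x = f y & map f a = r].
Proof.
move=> ud; elim: a r => [|a0 a IH] [|r0 r] //=.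
  by move=> _ _; exists (fun=> y0), 1; split.
move=> /andP[a0a ua] [/(IH _ ua)[f [delta [delta0 fl fa]]]].
have [m m0 ma] := positive_lower_bound a (d a0).
have [[d0 dE dC _] dU] := ud.
(* [m] keeps the ball off the points of [a]; [delta] is the scale at which the old [f] is
   constant. *)
pose s := Num.min m delta.
exists (fun x => if d a0 x < s then r0 else f x), s.
have s0 : 0 < s by rewrite lt_min m0.
split=> //.
- move=> x y xy.
  have -> : (d a0 x < s) = (d a0 y < s).
    apply/idP/idP => h.
      by apply: le_lt_trans (dU _ _ x) _; rewrite gt_max h xy.
    by apply: le_lt_trans (dU _ _ y) _; rewrite gt_max h dC xy.
  by case: ifP => // _; apply: fl; apply: lt_le_trans xy _; rewrite ge_min lexx orbT.
- rewrite metric_xx ?s0 //; last by case: ud.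
  congr cons; rewrite -[RHS]fa; apply/eq_in_map => x xa.
  rewrite ifF //; apply/negbTE; rewrite -leNgt ge_min ma //.
  rewrite lt0r d0 andbT; apply/eqP => /dE a0x.
  by rewrite a0x xa in a0a.
Qed.

End Ultrametrics.

(** * Changing an ultrametric annulus by annulus around a point *)

Section Gluing.
Context {R : realType} (S : set R) (X : topologicalType) (d : X -> X -> R).
Context (p : X) (h : R -> R) (T : R -> X -> X -> R).
Hypothesis Ud : UMet S X d.
Hypotheses (h_0 : h 0 = 0) (h_ge : forall t, t <= h t).
Hypothesis h_S : forall t, S t -> S (h t).
Hypothesis h_cont : forall r, 0 < r -> exists2 s, 0 < s & forall t, t < s -> h t < r.
Hypothesis T_ultra : forall l, is_ultrametric (T l).
Hypothesis T_S : forall l x y, S (T l x y).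
Hypothesis T_local : forall l, exists2 delta, 0 < delta &
  forall x y, d x y < delta \/ T l x y < delta -> T l x y = d x y.
Hypothesis T_bounded : forall l, T l = d \/ forall x y, T l x y <= l.

Let L x := h (d p x).

(* With L = d p and T l = d for all l this is d itself, by the isosceles
   property; so [h] coarsens the distance to [p] and [T] is free to change the
   metric inside each resulting annulus. *)
Definition glue (x y : X) : R :=
  if L x == L y then T (L x) x y else Num.max (L x) (L y).

Let ud : is_ultrametric d. Proof. by case: Ud. Qed.
Let d_ge0 x y : 0 <= d x y. Proof. by case: ud => -[]. Qed.
Let d_eq0 x y : d x y = 0 <-> x = y. Proof. by case: ud => -[]. Qed.
Let d_sym x y : d x y = d y x. Proof. by case: ud => -[]. Qed.
Let d_ultra x y z : d x y <= Num.max (d x z) (d z y). Proof. by case: ud. Qed.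

Let L_ge0 x : 0 <= L x. Proof. exact: le_trans (h_ge _). Qed.

Let L_p : L p = 0. Proof. by rewrite /L (metric_xx _ ud.1). Qed.

(** If [T] is still [d] on this level, both points are within [L x] of [p], since [h] never
    decreases a radius. *)
Let T_le x y : L x = L y -> T (L x) x y <= L x.
Proof.
move=> xy; case: (T_bounded (L x)) => [->|//].
apply: le_trans (d_ultra x y p) _.
by rewrite ge_max {2}xy d_sym !h_ge.
Qed.

Lemma glue_ultrametric : is_ultrametric glue.
Proof.
apply: is_ultrametricP; rewrite /glue.
- move=> x y; case: eqP => _; last by rewrite le_max L_ge0.
  by have [[]] := T_ultra (L x).
- move=> x y; case: eqP => xy; first by have [[_ + _ _] _] := T_ultra (L x).
  split=> [m0|xy']; last by case: xy; rewrite xy'.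
  have : Num.max (L x) (L y) <= 0 by rewrite m0.
  rewrite ge_max => /andP[x0 y0]; case: xy; apply/eqP.
  by rewrite eq_le (le_trans x0) ?(le_trans y0).
- move=> x y; rewrite (eq_sym (L y)) maxC; case: eqP => [xy|//].
  by rewrite -xy; have [[_ _ + _] _] := T_ultra (L x).
move=> x y z; case: (eqVneq (L x) (L z)) => xz.
  rewrite -xz; case: eqP => xy.
    by have [_] := T_ultra (L x).
  by rewrite le_max lexx orbT.
case: (eqVneq (L z) (L y)) => zy.
  rewrite -zy (negbTE xz).
  by rewrite le_max lexx.
(* Now [z] lies on a level different from those of [x] and [y], so the sides through [z] are maxima
   of levels; if [x] and [y] share a level, [T_le] bounds their distance by it. *)
case: eqP => xy; first by rewrite !le_max T_le.
by rewrite ge_max !le_max !lexx !orbT.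
Qed.

Let p_or x : x = p \/ 0 < d p x.
Proof.
case: (pselect (x = p)) => [|xp]; [by left|right].
by rewrite lt0r d_ge0 andbT; apply/eqP => /d_eq0/esym.
Qed.

Let glue_p y : glue p y = L y.
Proof.
rewrite /glue L_p; case: eqP => [y0|_]; last by apply/max_idPr.
(* Level 0 contains only [p], since otherwise [0 < d p y <= L y]. *)
rewrite -y0; case: (p_or y) => [->|py].
  by rewrite (metric_xx _ (T_ultra 0).1).
by have := h_ge (d p y); rewrite -/(L y) -y0 leNgt py.
Qed.

(** At [p] the new distance is [h] of the old one, so [h_ge] and [h_cont] compare the balls. At any
    other [x], small balls of either metric stay on the level of [x], where [T_local] identifies the
    two. *)
Lemma glue_UMet : UMet S X glue.
Proof.
split; first exact: glue_ultrametric.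
  move=> x y; rewrite /glue; case: eqP => _; first exact: T_S.
  have SL z : S (L z) by apply: h_S; case: Ud.
  by case: leP.
have [_ _ gd] := Ud; apply: generates_topology_equiv gd _ _ => x r r0.
  case: (p_or x) => [->|px].
    by have [s s0 hs] := h_cont r0; exists s => // y /hs; rewrite glue_p.
  have [delta delta0 Td] := T_local (L x).
  exists (Num.min (d p x) (Num.min delta r)); first by rewrite !lt_min px delta0.
  move=> y; rewrite !lt_min => /and3P[xy xyd xyr].
  have Lxy : L x = L y by rewrite /L (ultrametric_isosceles ud xy).
  by rewrite /glue -Lxy eqxx Td //; left.
case: (p_or x) => [->|px].
  by exists r => // y; rewrite glue_p; apply: le_lt_trans.
have [delta delta0 Td] := T_local (L x).
exists (Num.min (L x) (Num.min delta r)).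
  by rewrite !lt_min delta0 r0 (lt_le_trans px).
move=> y; rewrite /glue !lt_min => /and3P[].
case: eqP => [_ _ Txy|_]; first by rewrite Td //; right.
by rewrite gt_max ltxx.
Qed.

(** Pairs with both levels at most [s] have old and new distance at most [s]. Every other pair keeps
    its distance: on one level because [T] is [d] there, on two levels by the isosceles property. *)
Lemma glue_close (s : R) :
  (forall t, s < h t -> h t = t) -> (forall l, s < l -> T l = d) ->
  (forall x y, d x y <= Num.max (glue x y) s) /\
  (forall x y, glue x y <= Num.max (d x y) s).
Proof.
move=> hs Ts.
suff H x y : L y <= L x -> glue x y = d x y \/ (d x y <= s /\ glue x y <= s).
  have {}H x y : glue x y = d x y \/ (d x y <= s /\ glue x y <= s).
    case: (leP (L y) (L x)) => [/H//|/ltW/H].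
    by rewrite d_sym; have [[_ _ -> _] _] := glue_ultrametric.
  by split=> x y; rewrite le_max; case: (H x y) => [->|[de ed]];
    rewrite ?lexx ?de ?ed ?orbT.
move=> yx; case: (leP (L x) s) => xs.
  right; split.
    apply: le_trans (d_ultra x y p) _.
    rewrite ge_max d_sym (le_trans (h_ge _) xs).
    by rewrite (le_trans (h_ge _)) // (le_trans yx).
  rewrite /glue; case: eqP => [xy|_]; first exact: le_trans (T_le xy) xs.
  by rewrite ge_max xs (le_trans yx).
left; rewrite /glue; case: eqP => [xy|/eqP yx']; first by rewrite Ts.
have Lx : L x = d p x by exact: hs.
rewrite (max_idPl yx) Lx (d_sym p x); apply/esym/(ultrametric_isosceles ud).
rewrite (d_sym x p) -Lx; apply: le_lt_trans (h_ge _) _.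
by rewrite lt_neqAle eq_sym yx'.
Qed.

End Gluing.

(** * Values of [tp_phi] on isometric copies *)

Section Transmission.
Context {R : realType} (G : transmissible_parameter R).

(** (TP2) restricts [e] to the set [B] of points of [a], and [f] is an isometry of [B] onto [Y].
    Nothing is asked of [f] off [a], so a locally constant map on all of [X] can serve. *)
Lemma tp_phi_copy (X Y : topologicalType) (q : tp_Q G) (z : tp_Z G)
    (e : X -> X -> R) (rho : Y -> Y -> R) (f : X -> Y) (a : seq X) :
  Met R X e -> Met R Y rho -> Seq (tp_G q) _ (map f a) ->
  (forall y, y \in map f a) ->
  (forall x x', x \in a -> x' \in a -> rho (f x) (f x') = e x x') ->
  tp_phi q a z e = tp_phi q (map f a) z rho.
Proof.
move=> Me Mrho [ur Gr] rall iso.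
pose B := [set x | x \in a].
have [b ab] : exists b : seq (set_type B), map set_val b = a.
  have : forall x, x \in a -> B x by [].
  elim: (a) => [|x s IH] sB; first by exists [::].
  have [|b <-] := IH; first by move=> y ys; apply: sB; rewrite inE ys orbT.
  have Bx : x \in B by rewrite inE; apply: sB; rewrite mem_head.
  by exists ((exist _ x Bx : set_type B) :: b).
have Ba (x : set_type B) : set_val x \in a by have := set_valP x.
have ub : uniq b by move: ur; rewrite -ab -map_comp => /map_uniq.
have Gb : Seq (tp_G q) _ b by split=> //; move: Gr; rewrite -ab !size_map.
have isoB (x x' : set_type B) :
    rho (f (set_val x)) (f (set_val x')) = e (set_val x) (set_val x').
  exact: iso.
have injB : injective (f \o set_val : set_type B -> Y).
  move=> x x' /= ff; apply: val_inj.
  have [[_ eE _ _] _] := Me; apply/eE.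
  by rewrite -isoB ff (metric_xx _ Mrho.1).
have [g fg] : {g : Y -> set_type B & forall y, f (set_val (g y)) = y}.
  apply: (choice (P := fun y b => f (set_val b) = y)) => y.
  have := rall y; rewrite -ab -map_comp => /mapP[x _ ->].
  by exists x.
have bijB : bijective (f \o set_val : set_type B -> Y).
  by exists g => // x; apply: injB => /=; rewrite fg.
rewrite -[in LHS]ab (tp_restrict z Me Gb) -ab -map_comp; apply/esym.
exact: (tp_isometry z (Met_restrict B Me) Mrho bijB isoB Gb).
Qed.

End Transmission.

(** * Density: singular spaces planted in annuli shrinking to a point *)

Section Density.
Context {R : realType} (S : set R) (G : transmissible_parameter R).
Context (X : topologicalType) (d : X -> X -> R) (p : X) (u : nat -> R).
Hypotheses (Ud : UMet S X d) (np : ~ open [set p]).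
Hypotheses (u_S : forall n, S (u n)) (u_gt0 : forall n, 0 < u n).
Hypothesis u_lt : forall m n, (m < n)%N -> u n < u m.
Hypothesis u_to0 : forall r, 0 < r -> exists n, u n < r.

Let annulus (n n' : nat) : set X := [set x | u n' < d p x <= u n].

(** Each induction step takes a point closer to [p] than the inner radius, which exists as [p] is
    not isolated, and then moves the inner radius below it. *)
Lemma annulus_points (n N : nat) :
  exists n' (a : seq X), [/\ (n < n')%N, uniq a, size a = N &
    forall x, x \in a -> annulus n n' x].
Proof.
elim: N => [|N [n' [a [nn' ua sa aa]]]]; first by exists n.+1, [::].
have [ud _ gd] := Ud; have [[d_ge0 d_eq0 _ _] _] := ud.
have [x xp pxn'] := near_nonisolated gd np (u_gt0 n').
have px : 0 < d p x by rewrite lt0r d_ge0 andbT; apply/eqP => /d_eq0/esym.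
have [k ukx] := u_to0 px.
have n'k : (n' < k)%N.
  rewrite ltnNge leq_eqVlt; apply/negP => /predU1P[kn'|/u_lt kn'].
    by rewrite kn' ltNge (ltW pxn') in ukx.
  by have := lt_trans kn' (lt_trans ukx pxn'); rewrite ltxx.
exists k, (x :: a); split=> /=.
- exact: ltn_trans nn' n'k.
- rewrite ua andbT; apply/negP => /aa /andP[n'x _].
  by have := lt_trans n'x pxn'; rewrite ltxx.
- by rewrite sa.
move=> y; rewrite inE => /predU1P[->|/aa /andP[n'y yn]].
  by rewrite /annulus /= ukx (ltW (lt_trans pxn' (u_lt nn'))).
by rewrite /annulus /= yn (lt_trans (u_lt n'k)).
Qed.

(** [tau] is built before the glued metric is known, so the last clause covers every [e] that agrees
    with [tau] on the annulus, whatever happens elsewhere. *)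
Lemma singular_annulus (q : tp_Q G) (n : nat) : ultra_singular S G ->
  exists n' (tau : X -> X -> R),
  [/\ (n < n')%N, is_ultrametric tau /\ (forall x y, S (tau x y)),
      forall x y, tau x y <= u n,
      exists2 delta, 0 < delta &
        forall x y, d x y < delta \/ tau x y < delta -> tau x y = d x y &
      forall e, UMet S X e ->
        (forall x y, annulus n n' x -> annulus n n' y -> e x y = tau x y) ->
        exists z a, Seq (tp_G q) X a /\ ~ tp_F q (tp_phi q a z e)].
Proof.
move=> /(_ q (u n) (u_gt0 n)).
move=> [z [Y [rho [r [Urho [ur rall] diam_rho Gr nF]]]]].
have [n' [a [nn' ua sa aa]]] := annulus_points n (size r).
have [ud _ _] := Ud; have [[d_ge0 d_eq0 d_sym _] d_ultra] := ud.
have [urho rho_S _] := Urho.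
have [[rho_ge0 rho_eq0 rho_sym _] rho_ultra] := urho.
have rho_le y y' : rho y y' <= u n.
  rewrite -lee_fin; apply: le_trans diam_rho.
  by apply: ereal_sup_ubound; exists (y, y').
(* [Y] is nonempty because the lengths in [tp_G q] are positive; [y0] is the default value of
   [f]. *)
have [y0 _] : exists y : Y, y \in r.
  case: r ur rall Gr {sa nF} => [|y r] _ _; last by exists y; rewrite mem_head.
  by move=> /tp_G_gt0.
have [f [delta [delta0 f_loc fa]]] := locally_constant_extension y0 ud ua sa.
have [c c0 c_le] := positive_lower_bound [seq (y, y') | y <- r, y' <- r]
  (fun yy => rho yy.1 yy.2).
(* Below [c], the truncated [d] never exceeds a positive distance of [Y]; below [u n], it respects
   the outer radius. *)
have [k] : exists k, u k < Num.min c (u n).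
  by apply: u_to0; rewrite lt_min c0 u_gt0.
rewrite lt_min => /andP[/ltW kc /ltW kn].
pose m := u k; have m0 : 0 < m := u_gt0 k.
(* A copy of [rho] on [a], blown up to [X] by [f] and refined by [d] at scales
   below the least distance of [rho]. *)
pose tau x y := Num.max (Num.min (d x y) m) (rho (f x) (f y)).
exists n', tau; split=> //.
- split; last first.
    have Sd x y : S (d x y) by case: Ud.
    move=> x y; have Smin : S (Num.min (d x y) m).
      by case: leP => _; [exact: Sd|exact: u_S].
    by rewrite /tau; case: (leP (Num.min _ _)).
  apply: is_ultrametricP.
  + by move=> x y; rewrite le_max rho_ge0 orbT.
  + move=> x y; split=> [t0|->].
      have : tau x y <= 0 by rewrite t0.
      rewrite ge_max ge_min => /andP[/orP[xy|]]; last by rewrite leNgt m0.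
      by move=> _; apply/d_eq0/le_anti; rewrite xy d_ge0.
    rewrite /tau (metric_xx _ ud.1) (metric_xx _ urho.1).
    by rewrite (min_idPl (ltW m0)) maxxx.
  + by move=> x y; rewrite /tau d_sym rho_sym.
  move=> x y w; rewrite /tau ge_max; apply/andP; split.
    have := d_ultra x y w; rewrite !(le_max, le_min, ge_min, lexx, orbT, andbT).
    by move=> /orP[] -> /=; rewrite ?orbT ?andbT ?orbT.
  have := rho_ultra (f x) (f y) (f w); rewrite !le_max.
  by move=> /orP[->|->]; rewrite ?orbT.
- by move=> x y; rewrite ge_max rho_le ge_min kn orbT.
- exists (Num.min delta m); first by rewrite lt_min delta0.
  move=> x y xy.
  (* At this scale [f] is constant and the truncation at [m] inactive, so [tau] is [d]. A small
     [tau] forces a small [d] because [tau] dominates [min d m]. *)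
  have : d x y < Num.min delta m.
    case: xy => //; apply: contraTT; rewrite -!leNgt => dm.
    by rewrite /tau le_max le_min dm ge_min lexx orbT.
  rewrite lt_min => /andP[xyd xym].
  rewrite /tau (f_loc _ _ xyd) (metric_xx _ urho.1) (min_idPl (ltW xym)).
  exact/max_idPl.
move=> e Ue e_tau; exists z, a; split; first by split; rewrite ?sa.
have Gfa : Seq (tp_G q) Y (map f a) by rewrite fa.
have fall y : y \in map f a by rewrite fa.
rewrite (tp_phi_copy z (UMet_Met Ue) (UMet_Met Urho) Gfa fall) ?fa //.
move=> x x' xa xa'; rewrite (e_tau _ _ (aa _ xa) (aa _ xa')) /tau.
apply/esym; apply/max_idPr.
case: (eqVneq x x') => [->|xx'].
  by rewrite !(metric_xx _ ud.1) (metric_xx _ urho.1) ge_min lexx.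
have mr y : y \in a -> f y \in r by rewrite -fa => ya; apply: map_f.
(* [f] is injective on [a] because its list of images [r] has no repetition; the distance is then at
   least [c], hence at least [m]. *)
have ffx : 0 < rho (f x) (f x').
  rewrite lt0r rho_ge0 andbT; apply/eqP => /rho_eq0 ff; case/eqP: xx'.
  move: ur; rewrite -fa => /(@uniqP _ (f x)) ff_inj.
  have ia y : y \in a -> (index y a < size (map f a))%N.
    by rewrite size_map index_mem.
  have := ff_inj _ _ (ia _ xa) (ia _ xa').
  rewrite !(nth_map x) ?index_mem // !nth_index // => /(_ ff) /(congr1 (nth x a)).
  by rewrite !nth_index.
rewrite ge_min (le_trans kc) ?orbT //.
by apply: (c_le (f x, f x')) => //; apply: allpairs_f; apply: mr.
Qed.

Lemma anti_transmissible_approximation (q : nat -> tp_Q G) (eps : R) :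
  ultra_singular S G -> 0 < eps ->
  exists e, [/\ UMet S X e, (UD S d e < eps%:E)%E &
    forall i, exists z a, Seq (tp_G (q i)) X a /\ ~ tp_F (q i) (tp_phi (q i) a z e)].
Proof.
move=> Gs eps0.
have [k0 k0eps] := u_to0 eps0.
have [next nextP] := choice (fun ij : nat * nat =>
  singular_annulus (q ij.1) ij.2 Gs).
have [tau tauP] := choice nextP.
(* [u (n i)] is the outer radius of the i-th annulus and the inner radius of the one before.
   Starting at [k0] keeps every change below [eps]. *)
pose n := fix n i := if i is j.+1 then next (j, n j) else k0.
pose v i := u (n i); pose t i := tau (i, n i).
have tP i := tauP (i, n i).
have n_lt i : (n i < n i.+1)%N by have [] := tP i.
have n_mono i j : (i < j)%N -> (n i < n j)%N.
  elim: j => // j IH; rewrite ltnS leq_eqVlt => /predU1P[->//|/IH ij].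
  exact: ltn_trans ij (n_lt j).
have v_lt i j : (i < j)%N -> v j < v i by move=> /n_mono/u_lt.
have v_le i j : (i <= j)%N -> v j <= v i.
  by rewrite leq_eqVlt => /predU1P[->//|/v_lt/ltW].
have n_ge i : (i <= n i)%N by elim: i => // i IH; exact: leq_ltn_trans IH (n_lt i).
have v_to0 r : 0 < r -> exists i, v i < r.
  move=> /u_to0[i ir]; exists i; apply: le_lt_trans ir.
  by rewrite /v; move: (n_ge i); rewrite leq_eqVlt => /predU1P[<-|/u_lt/ltW].
have v_gt0 i : 0 < v i by exact: u_gt0.
have v_lt_ltn i j : v j < v i -> (i < j)%N.
  by move=> vij; rewrite ltnNge; apply/negP => /v_le; rewrite leNgt vij.
have v_inj i j : v i = v j -> i = j.
  move=> vij; case: (ltngtP i j) => // /v_lt; by rewrite vij ltxx.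
(* [h] sends the annulus ]v (i+1), v i] to its outer radius [v i]. *)
have [h hP] : {h : R -> R & forall s,
    (exists i, v i.+1 < s <= v i /\ h s = v i) \/
    ((forall i, ~ v i.+1 < s <= v i) /\ h s = s)}.
  apply: (choice (P := fun s r => (exists i, v i.+1 < s <= v i /\ r = v i) \/
    ((forall i, ~ v i.+1 < s <= v i) /\ r = s))) => s.
  case: (pselect (exists i, v i.+1 < s <= v i)) => [[i si]|si].
    by exists (v i); left; exists i.
  by exists s; right; split=> // i si'; apply: si; exists i.
have h_le s i : s <= v i -> h s <= v i.
  case: (hP s) => [[j [/andP[sj _] ->]]|[_ ->//]] si.
  by apply: v_le; rewrite -ltnS; apply/v_lt_ltn/(lt_le_trans sj si).
have h_ann i s : v i.+1 < s <= v i -> h s = v i.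
  move=> /[dup] si /andP[s1 s2]; case: (hP s) => [[j [/andP[j1 j2] ->]]|[/(_ i)//]].
  have := v_lt_ltn _ _ (lt_le_trans j1 s2).
  have := v_lt_ltn _ _ (lt_le_trans s1 j2).
  by rewrite !ltnS => ji ij; congr v; apply/anti_leq; rewrite ji.
(* Only the levels [v i] carry a new metric; by [v_inj] the index is determined by the level. *)
have [T TP] : {T : R -> X -> X -> R & forall l,
    (exists i, l = v i /\ T l = t i) \/ ((forall i, l <> v i) /\ T l = d)}.
  apply: (choice (P := fun l T => (exists i, l = v i /\ T = t i) \/
    ((forall i, l <> v i) /\ T = d))) => l.
  case: (pselect (exists i, l = v i)) => [[i li]|li].
    by exists (t i); left; exists i.
  by exists d; right; split=> // i li'; apply: li; exists i.
have Tv i : T (v i) = t i.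
  by case: (TP (v i)) => [[j [/v_inj <- ->//]]|[/(_ i)]].
have [ud d_S _] := Ud.
have h_0 : h 0 = 0.
  by case: (hP 0) => [[i [/andP[]]]|[]//]; rewrite ltNge ltW.
have h_ge s : s <= h s by case: (hP s) => [[i [/andP[_ ?] ->//]]|[_ ->]].
have h_S s : S s -> S (h s).
  by case: (hP s) => [[i [_ ->]] _|[_ ->//]]; exact: u_S.
have h_cont r : 0 < r -> exists2 s, 0 < s & forall x, x < s -> h x < r.
  move=> /v_to0[i ir]; exists (v i) => // x /ltW /h_le xi.
  exact: le_lt_trans xi ir.
have T_ultra l : is_ultrametric (T l).
  by case: (TP l) => [[i [_ ->]]|[_ ->//]]; have [_ []] := tP i.
have T_S l x y : S (T l x y).
  by case: (TP l) => [[i [_ ->]]|[_ ->]]; [have [_ [_ t_S] _ _ _] := tP i; exact: t_S|exact: d_S].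
have T_local l : exists2 delta, 0 < delta &
    forall x y, d x y < delta \/ T l x y < delta -> T l x y = d x y.
  case: (TP l) => [[i [_ ->]]|[_ ->]]; first by have [] := tP i.
  by exists 1.
have T_bounded l : T l = d \/ forall x y, T l x y <= l.
  case: (TP l) => [[i [-> ->]]|[_ ->]]; last by left.
  by right; have [] := tP i.
pose e := glue d p h T.
have Ue : UMet S X e by exact: glue_UMet.
exists e; split=> //.
  (* [v 0], which is [u k0], is the largest scale touched: above it [h] is the identity and [T] is
     [d]. *)
  have [||de ed] := glue_close p Ud h_ge T_ultra T_bounded (s := v 0%N).
  - move=> s; case: (hP s) => [[i [_ ->]]|[_ ->//]].
    by rewrite ltNge v_le.
  - move=> l; case: (TP l) => [[i [-> _]]|[_ ->//]].
    by rewrite ltNge v_le.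
  apply: le_lt_trans (UD_le (u_S k0) de ed) _.
  by rewrite lte_fin.
move=> i; have [_ _ _ _ /(_ e Ue)] := tP i; apply=> x y ix iy.
have hx : h (d p x) = v i by exact: h_ann.
have hy : h (d p y) = v i by exact: h_ann.
by rewrite /e /glue hx hy eqxx Tv.
Qed.

End Density.

(** * Openness in the topology of [UD] *)

Section GdeltaSet.
Context {R : realType} (S : set R) (G : transmissible_parameter R).
Context (X : topologicalType).

Lemma open_UMet_space (U : set (UMet_space S X)) :
  open U <-> metric_open (fun d e => UD S (set_val d) (set_val e)) U.
Proof. by []. Qed.

Lemma open_Met_space (U : set (Met_space R X)) :
  open U <-> metric_open (fun d e => sup_dist (set_val d) (set_val e)) U.
Proof. by []. Qed.

(** The same [z] and [a] remain witnesses near [d]: the complement of [tp_F q] is open, (TP1) gives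
    continuity for the sup distance, and [sup_dist_lt] makes the inclusion [incl] continuous. *)
Lemma open_singular (q : tp_Q G) : range_set S ->
  open [set d : UMet_space S X | exists z a, Seq (tp_G q) X a /\
    ~ tp_F q (tp_phi q a z (set_val d))].
Proof.
move=> S_range; apply/open_UMet_space => d [z [a [Ga nF]]].
have MetU (f : UMet_space S X) : set_val f \in Met R X.
  by rewrite inE; apply: (UMet_Met (S := S)); exact: set_valP.
pose incl f : Met_space R X := exist (fun g => g \in Met R X) _ (MetU f).
have /continuousP/(_ (~` tp_F q)) := tp_continuous (z := z) Ga.
rewrite openC => /(_ (@tp_F_closed _ _ q))/open_Met_space/(_ (incl d) nF)[r r0 rF].
exists r => // f df; exists z, a; split=> //.
apply: (rF (incl f)); apply: (sup_dist_lt S_range _ _ df) => x y.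
  by have [[[d_ge0 _ _ _] _] _ _] := set_valP d; exact: d_ge0.
by have [[[f_ge0 _ _ _] _] _ _] := set_valP f; exact: f_ge0.
Qed.

End GdeltaSet.

Theorem theorem6p7 (R : realType) (S : set R)
    (S_range : range_set S) (S_qc : quasi_complete S)
    (S_coinit : countable_coinitiality S)
    (G : transmissible_parameter R) (G_sing : ultra_singular S G)
    (X : topologicalType) (X_nondiscrete : ~ (forall x : X, open [set x]))
    (X_ultrametrizable : UMet S X !=set0) :
  let A := [set d : UMet_space S X | anti_transmissible G (set_val d)] in
  dense A /\ Gdelta A.
Proof.
move=> A.
have antiP (d : X -> X -> R) : anti_transmissible G d <->
    forall q : tp_Q G, exists z a, Seq (tp_G q) X a /\ ~ tp_F q (tp_phi q a z d).
  split=> [nt q|H [q Hq]]; last by have [z [a [Ga]]] := H q; apply; exact: Hq.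
  apply: contrapT => H; apply: nt; exists q => z a Ga.
  by apply: contrapT => nF; apply: H; exists z, a.
(* Parameters are enumerated by [nat], possibly with repetitions. An empty [tp_Q] admits no
   enumeration, but then no metric is transmissible and [A] is the whole space. *)
have [Q0|[q /(_ _ I) q_surj]] : [set: tp_Q G] = set0 \/
    exists q : nat -> tp_Q G, forall x, [set: tp_Q G] x -> exists i, q i = x.
  have /pfcard_geP[|[q]] := tp_Q_countable G; first by left.
  right; exists q => x _.
  by have [i _ <-] := 'surj_q (I : [set: tp_Q G] x); exists i.
  have -> : A = setT.
    apply/seteqP; split=> // d _; apply/antiP => q.
    by have : [set: tp_Q G] q by []; rewrite Q0.
  split; first by move=> O O0 _; rewrite setIT.
  exists (fun=> setT) => [_|]; first exact: openT.
  by rewrite bigcap_const //; exists 0%N.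
split; last first.
  exists (fun i => [set d : UMet_space S X | exists z a,
    Seq (tp_G (q i)) X a /\ ~ tp_F (q i) (tp_phi (q i) a z (set_val d))]).
    by move=> i; exact: open_singular.
  apply/seteqP; split=> d /=; first by move=> /antiP H i _; exact: H.
  by move=> H; apply/antiP => x; have [i <-] := q_surj x; exact: H.
move=> O [d Od] /open_UMet_space/(_ d Od)[r r0 rO].
have [p np] : exists p : X, ~ open [set p].
  by apply: contrapT => H; apply: X_nondiscrete => x; apply: contrapT => nx;
    apply: H; exists x.
have [u [u_S u_mono u_lim]] := S_coinit.
have u_lt m n : (m < n)%N -> u n < u m.
  (* [decreasing_seq] is an equivalence between the two orders, hence strict; this also makes every
     [u n] positive, being above [u n.+1]. *)
  by move=> mn; rewrite ltNge (u_mono n m) -ltnNge.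
have u_ge0 n : 0 <= u n by exact: S_range.2.
have u_gt0 n : 0 < u n by apply: le_lt_trans (u_lt _ _ (ltnSn n)).
have u_to0 s : 0 < s -> exists n, u n < s.
  move=> s0; move/cvgrPdist_lt: u_lim => /(_ s s0)[n _ /(_ n (leqnn n))] /=.
  by rewrite sub0r normrN ger0_norm //; exists n.
have [e [Ue de He]] := anti_transmissible_approximation (set_valP d) np
  u_S u_gt0 u_lt u_to0 q G_sing r0.
have eU : e \in UMet S X by rewrite inE.
exists (exist (fun g => g \in UMet S X) e eU); split; first exact: rO.
by apply/antiP => x; have [i <-] := q_surj x; exact: He.
Qed.
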